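(* Let $a_n(321)$ denote the number of irreducible permutations $\pi\in\mathcal{S}_n$ such that both $\pi$ and $\theta(\pi)$ avoid $321$. Then for $n\geq 2$, $$a_n(321)=\binom{n-2}{\lfloor (n-2)/2\rfloor},$$ and $\sum_{n\ge1} a_n(321)x^n = \dfrac{x-x^3c(x^2)}{1-x-x^2c(x^2)}$, where $c(x)=\frac{1-\sqrt{1-4x}}{2x}$ is the generating function of the Catalan numbers.
   Context: $\mathcal{S}_n$ is the symmetric group on $[n]$, permutations in one-line notation $\pi_1\cdots\pi_n$. A permutation avoids a pattern $\tau$ if it has no subsequence order-isomorphic to $\tau$. The standard cycle notation of $\pi$ writes each cycle (fixed points included) with its largest element first and orders cycles by increasing largest element. The fundamental bijection $\theta:\mathcal{S}_n\to\mathcal{S}_n$ maps $\pi$ to the permutation whose one-line notation is obtained by erasing the parentheses of the standard cycle notation of $\pi$. For $\pi\in\mathcal{S}_n$, $\tau\in\mathcal{S}_m$, the direct sum $\pi\oplus\tau\in\mathcal{S}_{n+m}$ is $\pi(i)$ for $i\le n$ and $\tau(i-n)+n$ for $i>n$. A permutation is reducible if it equals $\sigma\oplus\tau$ with both $\sigma,\tau$ nonempty, and irreducible otherwise. *)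

(* Defs.v *)
From HB Require Import structures.
From mathcomp Require Import all_boot all_order all_fingroup all_algebra.
From mathcomp Require Import boolp ring.

Set Implicit Arguments.
Unset Strict Implicit.
Unset Printing Implicit Defensive.

Import GRing.Theory.
Local Open Scope ring_scope.

(* The set [n] is represented by 'I_n = {0, ..., n-1}, shifting all
   values by one; the notions below are unaffected by the shift. *)

Section Patterns.
Local Open Scope nat_scope.

Definition contains m n (tau : 'S_m) (pi : 'S_n) : bool :=
  [exists f : {ffun 'I_m -> 'I_n}, forall i : 'I_m, forall j : 'I_m,
     ((f i < f j) == (i < j)) && ((pi (f i) < pi (f j)) == (tau i < tau j))].

Definition avoids m n (tau : 'S_m) (pi : 'S_n) : bool := ~~ contains tau pi.

Definition p321 : 'S_3 := perm (@rev_ord_inj 3).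

End Patterns.

Section FundamentalBijection.
Local Open Scope nat_scope.
Variables (n : nat) (pi : 'S_n).

Definition cycle_max (x : 'I_n) : bool := [forall y in porbit pi x, y <= x].

(* [enum 'I_n] is increasing, and [fingraph.orbit pi x] is x, pi x, pi (pi x), ...,
   that is, the cycle of x written starting from x. *)
Definition std_cycles : seq (seq 'I_n) :=
  [seq fingraph.orbit pi x | x <- enum 'I_n & cycle_max x].

Definition theta_word : seq 'I_n := flatten std_cycles.

Lemma fconnect_porbit (x y : 'I_n) : fconnect pi x y = (y \in porbit pi x).
Proof.
apply/idP/porbitP => [/iter_findex <-|[i ->]].
  by exists (findex pi x y); rewrite permX.
by rewrite permX fconnect_iter.
Qed.

Lemma uniq_theta_word : uniq theta_word.
Proof.
rewrite /theta_word /std_cycles.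
have: all cycle_max [seq x <- enum 'I_n | cycle_max x] by apply: filter_all.
have: uniq [seq x <- enum 'I_n | cycle_max x] by rewrite filter_uniq ?enum_uniq.
elim: [seq x <- _ | _] => //= x s IHs /andP[xs us] /andP[mx ms].
rewrite cat_uniq orbit_uniq IHs // andbT /=.
apply/hasPn => y /flattenP[_ /mapP[z zs ->]]; rewrite -!fconnect_orbit => zy.
apply: contra xs => xy.
have mz := allP ms z zs.
have eqxz : porbit pi x = porbit pi z.
  move: xy zy; rewrite !fconnect_porbit => xy zy.
  by move: xy zy; rewrite -!eq_porbit_mem => /eqP-> /eqP->.
suff -> : x = z by [].
apply/val_inj/eqP; rewrite eqn_leq.
move/forall_inP: mz => -> /=; last by rewrite -eqxz porbit_id.
by move/forall_inP: mx => -> //; rewrite eqxz porbit_id.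
Qed.

Lemma mem_theta_word (x : 'I_n) : x \in theta_word.
Proof.
case: (@arg_maxnP _ x (fun y => y \in porbit pi x) (fun y : 'I_n => y : nat)).
  exact: porbit_id.
move=> y yx ymax; apply/flattenP; exists (fingraph.orbit pi y); last first.
  by rewrite -fconnect_orbit fconnect_porbit -eq_porbit_mem eq_sym
             eq_porbit_mem.
apply/mapP; exists y => //; rewrite mem_filter mem_enum andbT.
apply/forall_inP => z zy; apply: ymax.
by move: zy yx; rewrite -!eq_porbit_mem => /eqP-> /eqP->.
Qed.

Lemma size_theta_word : size theta_word = n.
Proof.
rewrite -[RHS](size_enum_ord n); apply/perm_size/uniq_perm.
- exact: uniq_theta_word.
- exact: enum_uniq.
- by move=> x; rewrite mem_theta_word mem_enum.
Qed.

(* The default value of [nth] is never used, by [size_theta_word]. *)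
Definition theta_fun (i : 'I_n) : 'I_n := nth i theta_word i.

Lemma theta_fun_inj : injective theta_fun.
Proof.
move=> i j; rewrite /theta_fun (set_nth_default i) ?size_theta_word //.
move/eqP; rewrite nth_uniq ?size_theta_word // ?uniq_theta_word //.
by move/eqP/val_inj.
Qed.

Definition theta : 'S_n := perm theta_fun_inj.

Lemma theta_one_line : [seq theta i | i <- enum 'I_n] = theta_word.
Proof.
case def_w: theta_word => [|x0 w].
  apply: size0nil; rewrite size_map size_enum_ord.
  by rewrite -size_theta_word def_w.
rewrite -def_w; apply: (@eq_from_nth _ x0).
  by rewrite size_map size_enum_ord size_theta_word.
move=> i; rewrite size_map size_enum_ord => lt_in.
rewrite (nth_map x0) ?size_enum_ord // permE /theta_fun.
by rewrite nth_enum_ord // (set_nth_default x0) ?size_theta_word.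
Qed.

End FundamentalBijection.

Section DirectSum.
Local Open Scope nat_scope.

Section Def.
Variables (k m : nat) (sigma : 'S_k) (tau : 'S_m).

Definition dsum_fun (i : 'I_(k + m)) : 'I_(k + m) :=
  match split i with
  | inl j => lshift m (sigma j)
  | inr j => rshift k (tau j)
  end.

Lemma dsum_fun_inj : injective dsum_fun.
Proof.
move=> i j; rewrite /dsum_fun -[i]splitK -[j]splitK !unsplitK.
case: (split i) (split j) => [a|a] [b|b] //=.
- by move/lshift_inj/perm_inj->.
- by move/eqP; rewrite eq_lrshift.
- by move/eqP; rewrite eq_rlshift.
- by move/rshift_inj/perm_inj->.
Qed.

Definition dsum : 'S_(k + m) := perm dsum_fun_inj.

End Def.

(* pi = sigma (+) tau with sigma of size k and tau of size n - k, both
   nonempty: 0 < k < n. *)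
Definition reducible n (pi : 'S_n) : bool :=
  [exists k : 'I_n, (0 < k) &&
    [exists sigma : 'S_k, exists tau : 'S_(n - k),
       pi == cast_perm (subnKC (ltnW (ltn_ord k))) (dsum sigma tau)]].

Definition irreducible n (pi : 'S_n) : bool := ~~ reducible pi.

End DirectSum.

Definition a_num m (tau : 'S_m) (n : nat) : nat :=
  #|[set pi : 'S_n |
      [&& irreducible pi, avoids tau pi & avoids tau (theta pi)]]|.

(* Formal power series over a field, as a commutative ring whose units are the
   series with nonzero constant term. *)

Record fps (F : fieldType) := Fps { fcoef : nat -> F }.

Notation "f `_[ n ]" := (fcoef f n)
  (at level 3, n at level 200, left associativity, format "f `_[ n ]")
  : ring_scope.

HB.instance Definition _ (F : fieldType) := gen_eqMixin (fps F).
HB.instance Definition _ (F : fieldType) := gen_choiceMixin (fps F).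

Section Fps.
Variable F : fieldType.
Local Notation fps := (fps F).

Lemma fpsP (f g : fps) : (forall n, f`_[n] = g`_[n]) <-> f = g.
Proof.
split=> [|-> //]; case: f g => [f] [g] /= fg.
by congr Fps; apply/funext.
Qed.

(* The sequence u with u n = step [:: u 0; ...; u (n-1)]. *)
Fixpoint rec_seq (step : seq F -> F) (n : nat) : seq F :=
  if n is n'.+1 then rcons (rec_seq step n') (step (rec_seq step n')) else [::].

Definition fps_rec (step : seq F -> F) : fps :=
  Fps (fun n => step (rec_seq step n)).

Lemma fps_recE step n :
  (fps_rec step)`_[n] = step (mkseq (fcoef (fps_rec step)) n).
Proof.
suff -> : mkseq (fcoef (fps_rec step)) n = rec_seq step n by [].
by elim: n => // n IHn; rewrite mkseqS IHn.
Qed.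

Definition fps_zero : fps := Fps (fun=> 0).
Definition fps_one : fps := Fps (fun n => (n == 0)%N%:R).
Definition fps_opp (f : fps) : fps := Fps (fun n => - f`_[n]).
Definition fps_add (f g : fps) : fps := Fps (fun n => f`_[n] + g`_[n]).
Definition fps_mul (f g : fps) : fps :=
  Fps (fun n => \sum_(i < n.+1) f`_[i] * g`_[n - i]).

Fact fps_addA : associative fps_add.
Proof. by move=> f g h; apply/fpsP => n /=; rewrite addrA. Qed.
Fact fps_addC : commutative fps_add.
Proof. by move=> f g; apply/fpsP => n /=; rewrite addrC. Qed.
Fact fps_add0 : left_id fps_zero fps_add.
Proof. by move=> f; apply/fpsP => n /=; rewrite add0r. Qed.
Fact fps_addN : left_inverse fps_zero fps_opp fps_add.
Proof. by move=> f; apply/fpsP => n /=; rewrite addNr. Qed.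

HB.instance Definition _ :=
  GRing.isZmodule.Build fps fps_addA fps_addC fps_add0 fps_addN.

Definition fps_trunc (n : nat) (f : fps) : {poly F} :=
  \poly_(i < n.+1) f`_[i].

Lemma coef_fps_trunc n f i : (i <= n)%N -> (fps_trunc n f)`_i = f`_[i].
Proof. by move=> le_in; rewrite coef_poly ltnS le_in. Qed.

Lemma coef_fps_mul n f g i : (i <= n)%N ->
  (fps_mul f g)`_[i] = (fps_trunc n f * fps_trunc n g)`_i.
Proof.
move=> le_in; rewrite coefM /=; apply: eq_bigr => j _.
rewrite !coef_fps_trunc ?(leq_trans (leq_subr _ _)) //.
by rewrite (leq_trans _ le_in) // -ltnS.
Qed.

Fact fps_mulC : commutative fps_mul.
Proof.
by move=> f g; apply/fpsP => n; rewrite !(@coef_fps_mul n) // mulrC.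
Qed.

Fact fps_mulA : associative fps_mul.
Proof.
move=> f g h; apply/fpsP => n.
transitivity (fps_trunc n f * (fps_trunc n g * fps_trunc n h))`_n.
  rewrite coefM /=; apply: eq_bigr => i _.
  rewrite coef_fps_trunc ?leq_ord //; congr (_ * _).
  by rewrite -coef_fps_mul ?leq_subr.
rewrite mulrA coefM /=; apply: eq_bigr => i _.
rewrite [X in _ * X = _]coef_fps_trunc ?leq_subr //; congr (_ * _).
by rewrite -coef_fps_mul ?leq_ord.
Qed.

Fact fps_mul1 : left_id fps_one fps_mul.
Proof.
move=> f; apply/fpsP => n /=; rewrite big_ord_recl /= mul1r subn0.
by rewrite big1 ?addr0 // => i _; rewrite mul0r.
Qed.

Fact fps_mulD : left_distributive fps_mul fps_add.
Proof.
move=> f g h; apply/fpsP => n /=; rewrite -big_split /=.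
by apply: eq_bigr => i _; rewrite mulrDl.
Qed.

Fact fps_one_neq0 : fps_one != 0.
Proof. by apply/eqP => /fpsP/(_ 0%N) /= /eqP; rewrite oner_eq0. Qed.

HB.instance Definition _ := GRing.Zmodule_isComNzRing.Build fps
  fps_mulA fps_mulC fps_mul1 fps_mulD fps_one_neq0.

Definition fps_unit : pred fps := fun f => f`_[0] != 0.

Definition fps_inv (f : fps) : fps :=
  if fps_unit f then
    fps_rec (fun s => f`_[0]^-1 *
      ((size s == 0)%N%:R - \sum_(i < size s) s`_i * f`_[size s - i]))
  else f.

Fact fps_mulV : {in fps_unit, left_inverse 1 fps_inv *%R}.
Proof.
move=> f uf; apply/fpsP => n.
have fx : fps_unit f by [].
rewrite [LHS]/= big_ord_recr /= subnn.
rewrite /fps_inv fx [X in _ + X * _]fps_recE size_mkseq.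
rewrite mulrAC mulVf // mul1r addrC.
set S := (X in _ - X); suff -> : S = \sum_(i < n)
  (fps_rec (fun s => f`_[0]^-1 *
    ((size s == 0)%N%:R - \sum_(j < size s) s`_j * f`_[size s - j])))`_[i]
   * f`_[n - i] by rewrite subrK.
by apply: eq_bigr => i _; rewrite nth_mkseq.
Qed.

Fact fps_unitP (f g : fps) : g * f = 1 -> fps_unit f.
Proof.
move/fpsP/(_ 0%N); rewrite /= big_ord_recr big_ord0 /= add0r => gf.
apply/eqP => f0; move: gf; rewrite subnn f0 mulr0 => /esym/eqP.
by rewrite oner_eq0.
Qed.

Fact fps_inv_out : {in [predC fps_unit], fps_inv =1 id}.
Proof. by move=> f; rewrite /fps_inv => nuf; rewrite ifN. Qed.

HB.instance Definition _ := GRing.ComNzRing_hasMulInverse.Build fps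
  fps_mulV fps_unitP fps_inv_out.

Lemma fps_unitE (f : fps) : (f \is a GRing.unit) = (f`_[0] != 0).
Proof. by []. Qed.

Lemma fcoefM (f g : fps) n :
  (f * g)`_[n] = \sum_(i < n.+1) f`_[i] * g`_[n - i].
Proof. by []. Qed.

Lemma coef0_fps_nat (k : nat) : (k%:R : fps)`_[0] = k%:R.
Proof. by elim: k => // k IHk; rewrite !mulrS -IHk. Qed.

Definition fpsX : fps := Fps (fun n => (n == 1)%N%:R).

(* f(g(x)); meaningful only when g has zero constant term, so that g ^+ k does
   not contribute to the coefficient of x^n for k > n. *)
Definition fps_comp (f g : fps) : fps :=
  Fps (fun n => \sum_(k < n.+1) f`_[k] * (g ^+ k)`_[n]).

(* f(x)/x; meaningful only when f has zero constant term. *)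
Definition fps_divX (f : fps) : fps := Fps (fun n => f`_[n.+1]).

(* The square root with constant term 1 of a series with constant term 1:
   2 s_n = f_n - \sum_(0 < i < n) s_i s_(n-i) for n > 0. *)
Definition fps_sqrt (f : fps) : fps :=
  fps_rec (fun s => if s is [::] then 1 else
    (f`_[size s] - \sum_(1 <= i < size s) s`_i * s`_(size s - i)) / 2).

Lemma fps_mulX (f : fps) : f`_[0] = 0 -> fpsX * fps_divX f = f.
Proof.
move=> f0; apply/fpsP => -[|n] /=; first by rewrite big_ord1 /= mul0r f0.
rewrite big_ord_recl /= mul0r add0r big_ord_recl /= mul1r big1 ?addr0.
  by rewrite /bump /= subn1.
by move=> i _; rewrite mul0r.
Qed.

Lemma fps_sqrt0 (f : fps) : (fps_sqrt f)`_[0] = 1.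
Proof. by []. Qed.

Lemma fps_sqrtS (f : fps) n :
  (fps_sqrt f)`_[n.+1] = (f`_[n.+1] -
    \sum_(i < n) (fps_sqrt f)`_[i.+1] * (fps_sqrt f)`_[n - i]) / 2.
Proof.
set s := fps_sqrt f; rewrite {1}/s /fps_sqrt fps_recE -/(fps_sqrt f) -/s.
set t := mkseq _ _; have szt : size t = n.+1 by rewrite size_mkseq.
have ifE (b : F) : (if t is [::] then 1 else b) = b by case: (t) szt.
rewrite ifE.
rewrite szt; congr ((_ - _) / _).
rewrite big_add1 big_mkord; apply: eq_bigr => i _.
by rewrite !nth_mkseq ?subSS // ltnS ?leq_subr // ltnW.
Qed.

Lemma sqr_fps_sqrt (f : fps) :
  (2 : F) != 0 -> f`_[0] = 1 -> fps_sqrt f ^+ 2 = f.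
Proof.
move=> nz2 f0; apply/fpsP => n; rewrite expr2 fcoefM.
case: n => [|n]; first by rewrite big_ord1 fps_sqrt0 mulr1 f0.
move: (fps_sqrt0 f) (fps_sqrtS f n); move: (fps_sqrt f) => s s0 sS.
rewrite big_ord_recr big_ord_recl /= subnn subn0 s0 mul1r mulr1.
by rewrite sS; field.
Qed.

(* c(x) = (1 - sqrt (1 - 4x)) / (2x) *)
Definition catalan_gf : fps :=
  fps_divX ((1 - fps_sqrt (1 - 4%:R * fpsX)) / 2%:R).

Lemma catalan_gf_mulX : (2 : F) != 0 ->
  2%:R * fpsX * catalan_gf = 1 - fps_sqrt (1 - 4%:R * fpsX).
Proof.
move=> nz2; have u2 : (2%:R : fps) \is a GRing.unit by rewrite fps_unitE coef0_fps_nat.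
rewrite -mulrA fps_mulX; first by rewrite mulrC divrK.
by rewrite /= big_ord1 /= subrr mul0r.
Qed.

Lemma catalan_gf_eq : (2 : F) != 0 -> catalan_gf = 1 + fpsX * catalan_gf ^+ 2.
Proof.
move=> nz2; have X_inj (f g : fps) : fpsX * f = fpsX * g -> f = g.
  move=> /fpsP fg; apply/fpsP => n; have := fg n.+1; rewrite /=.
  rewrite !big_ord_recl /= !mul0r !add0r !mul1r !subn1 /=.
  by rewrite !big1 ?addr0 // => i _; rewrite mul0r.
have u4 : (4%:R : fps) \is a GRing.unit.
  by rewrite fps_unitE coef0_fps_nat (natrM _ 2 2) mulf_neq0.
apply: X_inj; apply: (mulrI u4).
have: fps_sqrt (1 - 4%:R * fpsX) ^+ 2 = 1 - 4%:R * fpsX.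
  by apply: sqr_fps_sqrt => //; rewrite /= big_ord1 mulr0 subr0.
have -> : fps_sqrt (1 - 4%:R * fpsX) = 1 - 2%:R * fpsX * catalan_gf.
  by rewrite catalan_gf_mulX //; ring.
move: catalan_gf => c sq.
suff : 4%:R * (fpsX * c) - 4%:R * (fpsX * (1 + fpsX * c ^+ 2)) = 0.
  by move/eqP; rewrite subr_eq0 => /eqP.
transitivity ((1 - 4%:R * fpsX) - (1 - 2%:R * fpsX * c) ^+ 2); first by ring.
by rewrite sq subrr.
Qed.

End Fps.

Arguments fpsX {F}.
Arguments catalan_gf {F}.

Definition a321_gf : fps rat :=
  Fps (fun n => if (1 <= n)%N then (a_num p321 n)%:R else 0).

(* Main.v *)
Require Import Defs.
From mathcomp Require Import all_boot all_order all_fingroup all_algebra.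
From mathcomp Require Import zify ring.

Set Implicit Arguments.
Unset Strict Implicit.
Unset Printing Implicit Defensive.

(* Since cycle maxima are the left-to-right maxima of the word of [theta pi],
   that word avoids 321 iff its other entries increase. For irreducible [pi]
   with n >= 2 this forces the cycle maxima to be exactly the deficiencies.
   Label x by D if it is a cycle maximum, by U if its preimage is one, and by N
   otherwise. Both avoidance conditions together say that the labels, read as
   down, up and level steps, form a path with level steps at height 1 only,
   and irreducibility says that it returns to height 0 only at its end. A
   321-avoiding permutation is recovered from its excedances and their values,
   so these paths count the permutations; removing the first and last steps
   leaves the paths of length n - 2 with level steps on the axis only. *)

(** * Patterns and reducibility *)

Section Permutations.
Variable n : nat.
Implicit Types (pi s : 'S_n) (x y z : 'I_n).

Lemma avoids321P s :
  reflect (forall i j k : 'I_n, i < j -> j < k -> s k < s j -> s j < s i -> False)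
          (avoids p321 s).
Proof.
apply: (iffP idP) => [/existsPn av i j k ij jk skj sji | av].
  pose f := [ffun a : 'I_3 => if a == ord0 then i else if a == ord_max then k else j].
  have /negP[] := av f; apply/forallP => -[[|[|[|a]]] lta] //;
  apply/forallP => -[[|[|[|b]]] ltb] //; rewrite !ffunE !permE /=;
  apply/andP; split; apply/eqP; lia.
apply/existsPn => f; apply/negP => /forallP fP.
pose j1 : 'I_3 := Ordinal (isT : 1 < 3).
have := fP ord0 => /forallP/(_ j1)/andP[/eqP f01 _].
have := fP j1 => /forallP/(_ ord_max)/andP[/eqP f12 _].
have := fP j1 => /forallP/(_ ord0)/andP[_ /eqP].
have := fP ord_max => /forallP/(_ j1)/andP[_ /eqP].
rewrite !permE /= => p1 p2.
by apply: (av (f ord0) (f j1) (f ord_max)); rewrite ?f01 ?f12 ?p1 ?p2.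
Qed.

Lemma reducibleP pi :
  reflect (exists k, [/\ 0 < k, k < n & forall x, x < k -> pi x < k])
          (reducible pi).
Proof.
apply: (iffP existsP) => [[k /andP[k0 /existsP[s /existsP[t /eqP ->]]]] | [k [k0 kn stab]]].
  exists k; split=> // x xk; rewrite cast_permE /=.
  rewrite permE /dsum_fun.
  case: (splitP (cast_ord _ x)) => /= j; first by move=> _; exact: ltn_ord.
  by move=> ej; move: xk; rewrite ej ltnNge leq_addr.
(* The initial segment is finite and stable, so it is mapped onto itself and no later position can
   enter it. *)
have stab' x : k <= x -> k <= pi x.
  move=> kx; rewrite leqNgt; apply/negP => pxk.
  pose A := [set z : 'I_n | z < k].
  have eqA : pi @: A = A.
    apply/eqP; rewrite eqEcard card_imset ?leqnn ?andbT; last exact: perm_inj.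
    by apply/subsetP => _ /imsetP[z + ->]; rewrite !inE; apply: stab.
  have : pi x \in A by rewrite inE.
  rewrite -eqA mem_imset ?inE; last exact: perm_inj.
  by rewrite ltnNge kx.
exists (Ordinal kn) => /=; rewrite k0 /=.
pose emb (i : 'I_k) : 'I_n := widen_ord (ltnW kn) i.
have embP i : pi (emb i) < k by apply: stab => /=.
pose sf (i : 'I_k) : 'I_k := Ordinal (embP i).
have sI : injective sf.
  by move=> i j /(congr1 val) /= /val_inj/perm_inj/(congr1 val)/= /val_inj.
have ltb (i : 'I_(n - k)) : k + i < n by have := ltn_ord i; lia.
pose emb2 (i : 'I_(n - k)) : 'I_n := Ordinal (ltb i).
have ge2 i : k <= pi (emb2 i) by apply: stab'; rewrite /= leq_addr.
have emb2P i : pi (emb2 i) - k < n - k.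
  by have := ge2 i; have := ltn_ord (pi (emb2 i)); lia.
pose tf (i : 'I_(n - k)) : 'I_(n - k) := Ordinal (emb2P i).
have tI : injective tf.
  move=> i j /(congr1 val) /= e.
  have /val_inj/perm_inj/(congr1 val)/= : val (pi (emb2 i)) = val (pi (emb2 j)).
    by have := ge2 i; have := ge2 j; rewrite /=; lia.
  by move/addnI/val_inj.
apply/existsP; exists (perm sI); apply/existsP; exists (perm tI).
apply/eqP/permP => x; apply/val_inj; rewrite cast_permE /= permE /dsum_fun.
case: (splitP (cast_ord _ x)) => /= j ej; rewrite permE /=.
  by congr (val (pi _)); apply/val_inj.
rewrite subnKC //; congr (val (pi _)); exact/val_inj.
Qed.

(** A finite set mapped into itself is mapped onto itself, so an entry from outside forces an exit.
    The exit serves below as the third term of a 321. *)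
Lemma perm_escape pi (A : {set 'I_n}) x :
  x \notin A -> pi x \in A -> exists2 z, z \in A & pi z \notin A.
Proof.
move=> xA pxA; case: (pickP [pred z | (z \in A) && (pi z \notin A)]) => [z /andP[]|stab].
  by exists z.
have eqA : pi @: A = A.
  apply/eqP; rewrite eqEcard card_imset ?leqnn ?andbT; last exact: perm_inj.
  apply/subsetP => _ /imsetP[z zA ->].
  by have := stab z; rewrite /= zA /= => /negbFE.
by move: pxA; rewrite -eqA mem_imset ?(negPf xA) //; exact: perm_inj.
Qed.

(** Since [y] is sent above itself, some [z > y] has [pi z <= y < pi y]; with [pi y < pi x] the
    positions [x], [y], [z] would form a 321. *)
Lemma avoids321_exc_incr pi x y : avoids p321 pi ->
  y < pi y -> x < y -> pi x < pi y.
Proof.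
move=> /avoids321P av ey xy; rewrite ltnNge leq_eqVlt; apply/negP => /orP[/eqP|lt].
  by move/val_inj/perm_inj => e; rewrite e ltnn in xy.
have [||z] := @perm_escape pi [set z : 'I_n | y < z] y; rewrite ?inE ?ltnn // => yz.
rewrite -leqNgt => pzy; apply: (av x y z) => //; lia.
Qed.

Lemma avoids321_def_incr pi x y : avoids p321 pi ->
  pi x < x -> x < y -> pi x < pi y.
Proof.
move=> /avoids321P av ex xy; rewrite ltnNge leq_eqVlt; apply/negP => /orP[/eqP|lt].
  by move/val_inj/perm_inj => e; rewrite e ltnn in xy.
have [||z] := @perm_escape pi [set z : 'I_n | z < x] x; rewrite ?inE ?ltnn // => zx.
rewrite -leqNgt => pzx; apply: (av z x y) => //; lia.
Qed.

(** A fixed point crossed by a larger value on its left is crossed by a smaller one on its right,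
    giving a 321. Otherwise it cuts the permutation into a direct sum. *)
Lemma avoids321_irreducible_nofix pi x :
  1 < n -> irreducible pi -> avoids p321 pi -> pi x <> x.
Proof.
move=> n1 /negP irr /avoids321P av fx; apply: irr; apply/reducibleP.
have low y : y < x -> pi y < x.
  move=> yx; rewrite ltnNge leq_eqVlt; apply/negP => /orP[/eqP/val_inj e|xpy].
    by have := @perm_inj _ pi y x; rewrite -e fx => /(_ erefl) e'; rewrite e' ltnn in yx.
  have [||z] := @perm_escape pi [set z : 'I_n | x < z] y; rewrite ?inE //.
    by rewrite -leqNgt ltnW.
  move=> xz; rewrite -leqNgt leq_eqVlt => /orP[/eqP/val_inj e|pzx].
    by have := @perm_inj _ pi z x; rewrite e fx => /(_ erefl) e'; rewrite e' ltnn in xz.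
  by apply: (av y x z); rewrite ?fx.
have [x0|x0] := posnP x; last by exists x; split.
(* A cut before position 0 would be empty, so a fixed point 0 is cut off on its right, with
   [n > 1]. *)
exists 1; split=> // y; rewrite ltnS leqn0 => /eqP y0.
by have -> : y = x; [apply/val_inj; rewrite /= x0 y0 | rewrite fx x0].
Qed.

End Permutations.

(** * The word of the fundamental bijection *)

Lemma allrel_flattenr (T S : Type) (r : T -> S -> bool) s ss :
  allrel r s (flatten ss) = all (allrel r s) ss.
Proof. by elim: ss => [|t ss /= IH] /=; rewrite ?allrel0r // allrel_catr IH. Qed.

Lemma pairwise_flatten (T : Type) (r : rel T) (ss : seq (seq T)) :
  pairwise r (flatten ss) = all (pairwise r) ss && pairwise (allrel r) ss.
Proof.
elim: ss => //= s ss IH; rewrite pairwise_cat allrel_flattenr IH.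
by rewrite [in LHS]andbCA -!andbA; congr (_ && _); rewrite andbCA.
Qed.

Lemma pairwise_enum_ltn n (A : {pred 'I_n}) :
  pairwise (fun i j : 'I_n => i < j) (enum A).
Proof.
rewrite {1}/enum_mem; apply: pairwise_filter; have := iota_ltn_sorted 0 n.
rewrite -val_enum_ord (sorted_pairwise ltn_trans) pairwise_map.
by rewrite enumT => h; exact: h.
Qed.

Section Theta.
Variable n : nat.
Implicit Types (pi : 'S_n) (x y z m : 'I_n).

Lemma mem_porbit1 pi x : pi x \in porbit pi x.
Proof. by rewrite -{1}[pi]expg1 mem_porbit. Qed.

Lemma cycle_max_inj pi x y :
  cycle_max pi x -> cycle_max pi y -> y \in porbit pi x -> x = y.
Proof.
move=> /forall_inP mx /forall_inP my yx; apply/val_inj/eqP; rewrite eqn_leq mx // my //.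
by rewrite porbit_sym.
Qed.

Lemma mem_orbit_porbit pi x y : (y \in fingraph.orbit pi x) = (y \in porbit pi x).
Proof. by rewrite -fconnect_orbit fconnect_porbit. Qed.

Lemma cycle_max_exists pi x : exists2 m, cycle_max pi m & x \in fingraph.orbit pi m.
Proof.
case: (@arg_maxnP _ x (fun y => y \in porbit pi x) (fun y : 'I_n => y : nat)).
  exact: porbit_id.
move=> y yx ymax; exists y; last by rewrite mem_orbit_porbit porbit_sym.
apply/forall_inP => z zy; apply: ymax.
by move: zy yx; rewrite -!eq_porbit_mem => /eqP-> /eqP->.
Qed.

(** In an increasing sequence the order of positions is that of values; this serves for the list of
    cycle maxima. *)
Lemma pairwise_ltn_ordP (r : rel 'I_n) (s : seq 'I_n) :
  pairwise (fun i j : 'I_n => i < j) s ->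
  reflect {in s &, forall x y, x < y -> r x y} (pairwise r s).
Proof.
move=> lts; apply: (iffP idP).
  elim: s lts => //= x s IH /andP[/allP ltx lts] /andP[/allP rx rs] u v.
  rewrite !inE => /predU1P[->|us] /predU1P[->|vs]; rewrite ?ltnn //.
  - by move=> _; exact: rx.
  - by have := ltx u us; lia.
  - exact: IH.
elim: s lts => //= x s IH /andP[/allP ltx lts] H; apply/andP; split.
  apply/allP => y ys; apply: H; rewrite ?mem_head ?inE ?ys ?orbT //; exact: ltx.
by apply: IH => // u v us vs; apply: H; rewrite inE ?us ?vs orbT.
Qed.

Lemma pairwise_theta_wordP pi (r : rel 'I_n) :
  reflect ((forall m, cycle_max pi m -> pairwise r (fingraph.orbit pi m)) /\
           (forall m m', cycle_max pi m -> cycle_max pi m' -> m < m' ->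
              allrel r (fingraph.orbit pi m) (fingraph.orbit pi m')))
          (pairwise r (theta_word pi)).
Proof.
rewrite /theta_word pairwise_flatten /std_cycles all_map pairwise_map.
have lts : pairwise (fun i j : 'I_n => i < j) [seq x <- enum 'I_n | cycle_max pi x].
  exact/pairwise_filter/pairwise_enum_ltn.
apply: (iffP andP) => [[/allP a /(pairwise_ltn_ordP _ lts) p]|[a p]].
  split=> [m mm|m m' mm mm' lt]; first by apply: a; rewrite mem_filter mm mem_enum.
  by apply: p; rewrite // mem_filter ?mm ?mm' mem_enum.
split; first by apply/allP => m; rewrite mem_filter => /andP[mm _]; exact: a.
apply/(pairwise_ltn_ordP _ lts) => m m'; rewrite !mem_filter => /andP[mm _] /andP[mm' _].
exact: p.
Qed.

Lemma pairwise_orbitP (f : 'I_n -> 'I_n) (r : rel 'I_n) m :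
  reflect (forall i j, i < j -> j < fingraph.order f m -> r (iter i f m) (iter j f m))
          (pairwise r (fingraph.orbit f m)).
Proof.
apply: (iffP (pairwiseP m)) => H i j.
  move=> ij jo; have := H i j; rewrite !inE size_orbit jo (ltn_trans ij jo).
  by rewrite !nth_traject ?(ltn_trans ij jo) // => /(_ isT isT ij).
rewrite !inE size_orbit => io jo ij; rewrite !nth_traject //; exact: H.
Qed.

Lemma cycle_max_iter pi m i : cycle_max pi m -> 0 < i < fingraph.order pi m ->
  ~~ cycle_max pi (iter i pi m).
Proof.
move=> mm /andP[i0 io]; apply/negP => mi.
have e : m = iter i pi m.
  by apply: cycle_max_inj mm mi _; rewrite -fconnect_porbit fconnect_iter.
have := findex_iter io; rewrite -e findex0 => e'; by rewrite -e' in i0.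
Qed.

(** A cycle maximum opens its cycle, and all earlier cycles have smaller maxima. The second conjunct
    is used to place the maximum before any other entry of its cycle. *)
Lemma theta_word_cycle_max pi :
  pairwise (fun x y => cycle_max pi y ==> (x < y) && (x \notin porbit pi y))
           (theta_word pi).
Proof.
apply/pairwise_theta_wordP; split=> [m mm|m m' mm mm' lt].
  apply/pairwise_orbitP => i j ij jo; apply/implyP => mj.
  have := @cycle_max_iter pi m j mm; rewrite mj jo andbT.
  by move/(_ (leq_ltn_trans (leq0n i) ij)).
apply/allrelP => x y xm ym; apply/implyP => my.
rewrite mem_orbit_porbit in xm; rewrite mem_orbit_porbit in ym.
have e := cycle_max_inj mm' my ym; subst y.
apply/andP; split.
  by move/forall_inP: mm => /(_ _ xm) xlm; apply: leq_ltn_trans lt.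
apply/negP => xm'; have e : m = m'; last by rewrite e ltnn in lt.
apply: (cycle_max_inj mm mm'); move: xm xm'.
by rewrite -!eq_porbit_mem => /eqP-> /eqP->.
Qed.

Lemma nth_theta_word pi x0 (i : 'I_n) : nth x0 (theta_word pi) i = theta pi i.
Proof. by rewrite permE /theta_fun (set_nth_default i) // size_theta_word. Qed.

Lemma pairwise_thetaP pi (r : rel 'I_n) :
  reflect (forall i j : 'I_n, i < j -> r (theta pi i) (theta pi j))
          (pairwise r (theta_word pi)).
Proof.
apply: (iffP idP) => [pw i j ij|H].
  have /(pairwiseP i)/(_ i j) := pw; rewrite !inE size_theta_word !ltn_ord.
  by rewrite !nth_theta_word => /(_ isT isT ij).
case: (posnP n) => [n0|n0].
  by have /size0nil-> : size (theta_word pi) = 0 by rewrite size_theta_word n0.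
apply/(pairwiseP (Ordinal n0)) => i j; rewrite !inE size_theta_word => ilt jlt ij.
rewrite -[i]/(val (Ordinal ilt)) -[j]/(val (Ordinal jlt)) !nth_theta_word.
exact: H.
Qed.

(* The cycle maxima are the left-to-right maxima of the word, and in a
   321-avoiding word the remaining entries increase. *)
Lemma avoids321_theta pi :
  avoids p321 (theta pi) =
  pairwise (fun x y => ~~ cycle_max pi x ==> ~~ cycle_max pi y ==> (x < y))
           (theta_word pi).
Proof.
have /pairwise_thetaP lr := theta_word_cycle_max pi.
apply/idP/idP => [/avoids321P av|/pairwise_thetaP inc].
  apply/pairwise_thetaP => i j ij; apply/implyP => nx; apply/implyP => ny.
  rewrite ltnNge leq_eqVlt; apply/negP => /orP[/eqP/val_inj/perm_inj e|lt].
    by rewrite e ltnn in ij.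
  (* The maximum of the cycle of the larger entry stands before it, and would complete the descent
     to a 321. *)
  have [m mm] := cycle_max_exists pi (theta pi i).
  rewrite mem_orbit_porbit => xm.
  have [k ek] : exists k, m = theta pi k by exists ((theta pi)^-1 m)%g; rewrite permKV.
  subst m; have ki : k < i.
    rewrite ltnNge leq_eqVlt; apply/negP => /orP[/eqP/val_inj e|ik].
      by rewrite e mm in nx.
    by have := lr _ _ ik; rewrite mm xm andbF.
  apply: (av k i j) => //; move/forall_inP: mm => /(_ _ xm).
  rewrite leq_eqVlt => /orP[/eqP/val_inj/perm_inj e|//].
  by rewrite e ltnn in ki.
apply/avoids321P => i j k ij jk skj sji.
have nj : ~~ cycle_max pi (theta pi j).
  by apply/negP => mj; have := lr _ _ ij; rewrite mj /=; lia.
have nk : ~~ cycle_max pi (theta pi k).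
  by apply/negP => mk; have := lr _ _ jk; rewrite mk /=; lia.
by have := inc _ _ jk; rewrite nj nk /=; lia.
Qed.

End Theta.

(** * Counting functions of sets of positions *)

Section Below.
Variable n : nat.
Implicit Types (A B : {set 'I_n}) (pi : 'S_n) (x y z : 'I_n) (k l : nat).

(** With [k] a natural number, [k = n] is allowed. For [x] in [A], [below A x] is the rank of [x] in
    [A], counted from 0. *)
Definition below A k := #|[set x in A | x < k]|.

Definition incr_on A (f : 'I_n -> 'I_n) := {in A &, forall x y, x < y -> f x < f y}.

Lemma below0 A : below A 0 = 0.
Proof. by apply: eq_card0 => x; rewrite inE ltn0 andbF. Qed.

Lemma below_full A : below A n = #|A|.
Proof. by apply: eq_card => x; rewrite inE ltn_ord andbT. Qed.

Lemma belowS A x : below A x.+1 = (x \in A) + below A x.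
Proof.
rewrite /below (cardsD1 x) !inE leqnn andbT; congr (_ + _).
apply: eq_card => y; rewrite !inE ltnS ltn_neqAle -(inj_eq val_inj) /=.
by case: eqP; rewrite ?andbF ?andbT.
Qed.

Lemma below_split A B k : below A k = below (A :&: B) k + below (A :\: B) k.
Proof.
rewrite /below -(cardsID B [set x in A | x < k]); congr (_ + _);
by apply: eq_card => x; rewrite !inE; case: (x \in A); case: (x \in B);
   rewrite /= ?andbT ?andbF.
Qed.

Lemma belowC A k : k <= n -> below A k + below (~: A) k = k.
Proof.
have := below_split setT A k; rewrite setTI setTD => <-.
elim: k => [|k IH] kn; first exact: below0.
by rewrite (belowS setT (Ordinal kn)) inE IH // ltnW.
Qed.

Lemma leq_below A k l : k <= l -> below A k <= below A l.
Proof.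
move=> kl; apply/subset_leq_card/subsetP => x; rewrite !inE => /andP[-> xk].
exact: leq_trans kl.
Qed.

Lemma ltn_below A x k : x \in A -> x < k -> below A x < below A k.
Proof.
move=> xA xk; apply: leq_trans (leq_below A xk).
by rewrite belowS xA.
Qed.

Lemma ltn_below_ex A k l : below A k < below A l -> exists2 z, z \in A & k <= z < l.
Proof.
move=> lt; case: (pickP [pred z | (z \in A) && (k <= z < l)]) => [z /andP[]|no].
  by exists z.
suff : below A l <= below A k by rewrite leqNgt lt.
apply/subset_leq_card/subsetP => x; rewrite !inE => /andP[xA xl]; rewrite xA /=.
by have := no x; rewrite /= xA xl andbT /= ltnNge => ->.
Qed.

Lemma below_inj A x y : x \in A -> y \in A -> below A x = below A y -> x = y.
Proof.
move=> xA yA e; apply/val_inj; case: (ltngtP x y) => // lt.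
  by have := ltn_below xA lt; rewrite e ltnn.
by have := ltn_below yA lt; rewrite e ltnn.
Qed.

Lemma incr_on_inv A f : incr_on A f -> {in A &, forall x y, f x < f y -> x < y}.
Proof.
move=> inc x y xA yA lt; case: (ltngtP x y) => // [yx|/val_inj e].
  by have := inc y x yA xA yx; lia.
by move: lt; rewrite e ltnn.
Qed.

Lemma below_imset A pi x : incr_on A pi -> x \in A -> below (pi @: A) (pi x) = below A x.
Proof.
move=> inc xA; rewrite /below -[RHS](card_imset _ (@perm_inj _ pi)).
apply: eq_card => z; rewrite inE; apply/andP/imsetP.
  move=> [/imsetP[y yA ->] lt]; exists y => //; rewrite inE yA /=.
  exact: (incr_on_inv inc) lt.
move=> [y]; rewrite inE => /andP[yA yx] ->; split; last exact: inc.
exact: imset_f.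
Qed.

(** An increasing map preserves ranks, and the rank determines an element of the image. *)
Lemma incr_on_eq A pi pi' : incr_on A pi -> incr_on A pi' -> pi @: A = pi' @: A ->
  {in A, pi =1 pi'}.
Proof.
move=> inc inc' e x xA; apply: (@below_inj (pi @: A)); rewrite ?imset_f //.
  by rewrite e imset_f.
by rewrite below_imset // e below_imset.
Qed.

Lemma incr_fun_exists A B : #|A| = #|B| ->
  exists2 f : 'I_n -> 'I_n, incr_on A f & {in A, forall x, f x \in B}.
Proof.
move=> eAB; exists (fun x => nth x (enum B) (index x (enum A))).
  move=> x y; rewrite -!(mem_enum A) => xA yA xy.
  have ix : index x (enum A) < size (enum B) by rewrite -cardE -eAB cardE index_mem.
  have iy : index y (enum A) < size (enum B) by rewrite -cardE -eAB cardE index_mem.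
  rewrite (set_nth_default x y) //.
  have /(pairwiseP x) h := pairwise_enum_ltn B.
  apply: h; rewrite ?inE //; rewrite ltnNge leq_eqVlt; apply/negP => /orP[/eqP e|lt].
    by move: xy; rewrite -(nth_index x xA) -(nth_index x yA) e ltnn.
  have /(pairwiseP x) h := pairwise_enum_ltn A.
  have := h (index y (enum A)) (index x (enum A)); rewrite !inE !index_mem => /(_ yA xA lt).
  by rewrite !nth_index //; lia.
move=> x; rewrite -mem_enum => xA; rewrite -mem_enum mem_nth //.
by rewrite -cardE -eAB cardE index_mem.
Qed.

Lemma incr_perm_exists A B : #|A| = #|B| ->
  exists pi, [/\ pi @: A = B, incr_on A pi & incr_on (~: A) pi].
Proof.
move=> eAB; have [f fI fB] := incr_fun_exists eAB.
have eAB' : #|~: A| = #|~: B| by have := cardsC A; have := cardsC B; lia.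
have [g gI gB] := incr_fun_exists eAB'.
pose h x := if x \in A then f x else g x.
have hI : injective h.
  move=> x y; rewrite /h; case: ifPn => xA; case: ifPn => yA e.
  - apply/val_inj; case: (ltngtP x y) => // lt; first have := fI x y xA yA lt.
      by rewrite e ltnn.
    by have := fI y x yA xA lt; rewrite e ltnn.
  - by have := fB x xA; have := gB y; rewrite !inE -e => /(_ yA)/negPf->.
  - by have := fB y yA; have := gB x; rewrite !inE e => /(_ xA)/negPf->.
  - apply/val_inj; case: (ltngtP x y) => // lt.
      by have := gI x y; rewrite !inE e ltnn => /(_ xA yA lt).
    by have := gI y x; rewrite !inE e ltnn => /(_ yA xA lt).
exists (perm hI); split.
- apply/eqP; rewrite eqEcard card_imset ?eAB ?leqnn ?andbT; last exact: perm_inj.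
  by apply/subsetP => _ /imsetP[x xA ->]; rewrite permE /h xA fB.
- by move=> x y xA yA xy; rewrite !permE /h xA yA; exact: fI.
- move=> x y xA yA xy; rewrite !permE /h.
  by move: (xA) (yA); rewrite !inE => /negPf-> /negPf->; apply: gI.
Qed.

End Below.

(** * Permutations and lattice paths *)

Section Correspondence.
Variable n : nat.
Implicit Types (A B Q : {set 'I_n}) (pi : 'S_n) (x y z m : 'I_n) (k l : nat).

Definition exc pi := [set x : 'I_n | x < pi x].

Definition fair pi :=
  [&& irreducible pi, avoids p321 pi & avoids p321 (theta pi)].

(* Reading [~: Q] as up steps, [~: B] as down steps and [B :&: Q] as level
   steps, [below B k - below Q k] is the height after k steps: the path stays
   positive between its endpoints and its level steps are all at height 1. *)
Definition path_pair B Q :=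
  [/\ ~: B \subset Q, (forall k, 0 < k < n -> below Q k < below B k),
      #|B| = #|Q| & (forall x, x \in B -> x \in Q -> below B x = (below Q x).+1)].

(** * From permutations to paths *)

Section Forward.
Variable pi : 'S_n.
Hypotheses (n_gt1 : 1 < n) (fair_pi : fair pi).

Let irr : irreducible pi. Proof. by case/and3P: fair_pi. Qed.
Let av : avoids p321 pi. Proof. by case/and3P: fair_pi. Qed.
Let inc : pairwise (fun x y => ~~ cycle_max pi x ==> ~~ cycle_max pi y ==> (x < y))
           (theta_word pi).
Proof. by case/and3P: fair_pi => _ _; rewrite avoids321_theta. Qed.

Lemma fair_nofix x : (pi x == x) = false.
Proof. by apply/eqP; exact: avoids321_irreducible_nofix. Qed.

Lemma fair_cycle_max x : cycle_max pi x = (x \notin exc pi).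
Proof.
rewrite inE -leqNgt; apply/idP/idP => [/forall_inP|].
  by apply; rewrite mem_porbit1.
apply: contraTT => nx; rewrite -ltnNge.
have [mpx|npx] := boolP (cycle_max pi (pi x)).
  have : x \in porbit pi (pi x) by rewrite porbit_sym mem_porbit1.
  move/(forall_inP mpx); rewrite leq_eqVlt => /orP[/eqP/val_inj/esym/eqP|//].
  by rewrite fair_nofix.
have [m mm] := cycle_max_exists pi x; move=> /trajectP[i io ex].
(* Unless it closes the cycle, and so is its maximum, [pi x] stands right after [x] in the word; two
   adjacent non-maxima increase. *)
have [i1o|i1o] := ltnP i.+1 (fingraph.order pi m); last first.
  have e : i.+1 = fingraph.order pi m by apply/eqP; rewrite eqn_leq io i1o.
  move: npx; rewrite ex -[pi _]/(iter i.+1 pi m) e iter_order ?mm //; exact: perm_inj.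
have [/(_ m mm)/pairwise_orbitP/(_ i i.+1 (leqnn _) i1o) + _] := pairwise_theta_wordP _ _ inc.
by rewrite /= -ex nx npx.
Qed.

(** In the word [pi y] directly follows [y], and the non-maxima increase along the word, which
    leaves no place for [x]. This puts the level steps at height 1. *)
Lemma fair_no_between x y : y \in exc pi -> x \in exc pi -> pi y \in exc pi ->
  y < x -> x < pi y -> False.
Proof.
rewrite -[y \in _]negbK -[x \in _]negbK -[pi y \in _]negbK -!fair_cycle_max.
move=> ny nx npy yx xpy.
have [orb sep] := pairwise_theta_wordP _ _ inc.
have [m mm ym] := cycle_max_exists pi y; have [m' mm' xm'] := cycle_max_exists pi x.
have pym : pi y \in fingraph.orbit pi m by apply: fingraph.mem_orbit.
case: (ltngtP m m') => [lt|lt|/val_inj e].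
- have /allrelP/(_ _ _ pym xm') := sep _ _ mm mm' lt; rewrite nx npy /=; lia.
- have /allrelP/(_ _ _ xm' ym) := sep _ _ mm' mm lt; rewrite nx ny /=; lia.
subst m'; have /pairwise_orbitP r := orb m mm.
move: ym xm' => /trajectP[i io ey] /trajectP[j jo ex].
have [ij|ji] := ltnP i j; last first.
  move: ji; rewrite leq_eqVlt => /orP[/eqP e|ji].
    by move: yx; rewrite ex ey e ltnn.
  by have := r j i ji io; rewrite -ex -ey nx ny /=; lia.
move: ij; rewrite leq_eqVlt => /orP[/eqP e|ij].
  by move: xpy; rewrite ex ey -e /= ltnn.
have := r i.+1 j ij jo; rewrite -ex /= -ey nx npy /=; lia.
Qed.

Lemma fair_incr_exc : incr_on (exc pi) pi.
Proof. by move=> x y _; rewrite inE => ey xy; apply: avoids321_exc_incr. Qed.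

Lemma fair_incr_def : incr_on (~: exc pi) pi.
Proof.
move=> x y; rewrite !inE -leqNgt => ex _; apply: avoids321_def_incr => //.
by move: ex; rewrite leq_eqVlt => /orP[/eqP/val_inj/eqP|//]; rewrite fair_nofix.
Qed.

Lemma fair_path_pair : path_pair (exc pi) (pi @: exc pi).
Proof.
split; last 2 first.
- by rewrite card_imset //; exact: perm_inj.
- move=> x xB /imsetP[y0 y0B ex].
  (* An excedance [y < x] with [pi y > x = pi y0] would lie strictly between [y0] and [pi y0]. *)
  suff e : pi @: [set y in exc pi | y < x] = x |: [set z in pi @: exc pi | z < x].
    rewrite /below -[LHS](card_imset _ (@perm_inj _ pi)) e cardsU1 !inE ltnn andbF.
    by rewrite add1n.
  apply/setP => z; apply/imsetP/idP => [[y]|]; last first.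
    rewrite !inE => /predU1P[->|/andP[/imsetP[y yB ->] lt]].
      by exists y0 => //; rewrite inE y0B /= ex; move: y0B; rewrite inE.
    by exists y => //; rewrite inE yB /=; move: (yB); rewrite inE => /ltn_trans->.
  rewrite inE => /andP[yB yx] ->; rewrite !inE imset_f //=.
  rewrite -(inj_eq val_inj) /= -leq_eqVlt leqNgt; apply/negP => lt.
  apply: (@fair_no_between y y0) => //; rewrite -?ex //.
  by apply: (incr_on_inv fair_incr_exc) => //; rewrite -ex.
(* A cycle maximum exceeds its preimage, so it is the value of an excedance. *)
- apply/subsetP => x; rewrite inE -fair_cycle_max => /forall_inP mx.
  have [y ey] : exists y, x = pi y by exists (pi^-1 x)%g; rewrite permKV.
  rewrite ey imset_f // inE -ey ltn_neqAle mx; last first.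
    by rewrite porbit_sym ey mem_porbit1.
  by rewrite andbT (inj_eq val_inj) ey eq_sym fair_nofix.
move=> k /andP[k0 kn]; rewrite /below -[ltnRHS](card_imset _ (@perm_inj _ pi)).
(* Irreducibility gives a position before [k] with value at least [k]: an excedance counted in [B]
   but whose value is not yet counted in [Q]. *)
have [x xk pxk] : exists2 x : 'I_n, x < k & k <= pi x.
  case: (pickP [pred x : 'I_n | (x < k) && (k <= pi x)]) => [x /andP[]|no].
    by exists x.
  move/negP: irr; case; apply/reducibleP; exists k; split=> // x xk.
  by have := no x; rewrite /= xk /= leqNgt => /negbFE.
apply/proper_card/properP; split.
  apply/subsetP => z; rewrite inE => /andP[/imsetP[y yB ->] lt].
  by apply: imset_f; rewrite inE yB /=; move: yB; rewrite inE => /ltn_trans->.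
exists (pi x); last by rewrite inE ltnNge pxk andbF.
by apply: imset_f; rewrite !inE xk (leq_trans xk pxk).
Qed.

End Forward.

(** The permutation increases on its excedances and on the other positions, so both restrictions are
    determined by their domains and images. *)
Lemma fair_inj pi pi' : 1 < n -> fair pi -> fair pi' ->
  exc pi = exc pi' -> pi @: exc pi = pi' @: exc pi' -> pi = pi'.
Proof.
move=> n1 f f' eB eQ; apply/permP => x.
have [xB|xB] := boolP (x \in exc pi).
  apply: (incr_on_eq (fair_incr_exc f)) => //; last by rewrite eQ eB.
  by rewrite eB; exact: fair_incr_exc.
have imC (s : 'S_n) A : s @: (~: A) = ~: (s @: A).
  apply/eqP; rewrite eqEcard; apply/andP; split; last first.
    have := cardsC A; have := cardsC (s @: A).
    rewrite !card_imset; [lia | exact: perm_inj | exact: perm_inj].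
  apply/subsetP => _ /imsetP[y yA ->]; rewrite inE mem_imset; last exact: perm_inj.
  by move: yA; rewrite inE.
have xC : x \in ~: exc pi by rewrite inE.
apply: (incr_on_eq (fair_incr_def n1 f)) => //; last by rewrite imC eQ eB imC.
by rewrite eB; exact: fair_incr_def.
Qed.

(** * From paths to permutations *)

Section Backward.
Variables (B Q : {set 'I_n}) (pi : 'S_n).
Hypotheses (n_gt1 : 1 < n) (pBQ : path_pair B Q) (piB : pi @: B = Q).
Hypotheses (incB : incr_on B pi) (incC : incr_on (~: B) pi).

Let pi_B x : x \in B -> below Q (pi x) = below B x.
Proof. by move=> xB; rewrite -piB below_imset. Qed.

Let mem_pi x : (pi x \in Q) = (x \in B).
Proof. by rewrite -piB mem_imset //; exact: perm_inj. Qed.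

Let pi_C x : x \notin B -> below (~: Q) (pi x) = below (~: B) x.
Proof.
move=> xB; rewrite -(below_imset incC) ?inE //; congr below.
apply/setP => y; rewrite -[y](permKV pi) inE mem_pi mem_imset ?inE //; exact: perm_inj.
Qed.

Let CQ_B x : x \notin Q -> x \in B.
Proof. by case: pBQ => /subsetP sub _ _ _; apply: contraR => xB; apply: sub; rewrite inE. Qed.

(** Equal ranks correspond under [pi]. Positive height puts each element of [Q] after the element of
    [B] of the same rank, and no element of [~: Q] after its counterpart in [~: B]. *)
Lemma path_exc : exc pi = B.
Proof.
have [_ pos eqc lev] := pBQ; apply/setP => x; rewrite inE.
have [xB|xB] := boolP (x \in B).
  rewrite ltnNge; apply/negP => pxx.
  have lt : below Q (pi x) < below Q x.+1 by apply: ltn_below; rewrite ?mem_pi ?ltnS.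
  rewrite pi_B // in lt; have := belowS B x; rewrite xB.
  have [x1n|x1n] := ltnP x.+1 n; first by have := pos x.+1 x1n; lia.
  (* Positivity says nothing about the end of the path; there the equal sizes of [B] and [Q] are
     used. *)
  have e : x.+1 = n by have := ltn_ord x; lia.
  have eB : below B x.+1 = #|B| by rewrite -below_full; congr below.
  have eQ : below Q x.+1 = #|Q| by rewrite -below_full; congr below.
  have x0 : 0 < x by lia.
  have := pos x; rewrite x0 ltn_ord => /(_ isT).
  have := belowS Q x; have := lev x xB; case: (x \in Q); last lia.
  move/(_ isT); lia.
apply/negbTE; rewrite -leqNgt leqNgt; apply/negP => lt.
have x0 : 0 < x.
  rewrite lt0n; apply/negP => /eqP e; have := pos 1; rewrite n_gt1 => /(_ isT).
  by rewrite -e !belowS (negPf xB) e !below0; lia.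
have := pos x; rewrite x0 ltn_ord => /(_ isT).
have := belowC Q (ltnW (ltn_ord x)); have := belowC B (ltnW (ltn_ord x)).
by have := leq_below (~: Q) (ltnW lt); rewrite pi_C //; lia.
Qed.

(** Two of any three positions lie both in [B] or both outside it, and [pi] increases on each of
    these sets. *)
Lemma path_avoids : avoids p321 pi.
Proof.
apply/avoids321P => i j k ij jk kj ji.
have ik := ltn_trans ij jk.
have [iB|iB] := boolP (i \in B); have [jB|jB] := boolP (j \in B);
have [kB|kB] := boolP (k \in B);
do ?[by have := incB iB jB ij; lia | by have := incB iB kB ik; lia
    | by have := incB jB kB jk; lia];
have := @incC i j; have := @incC i k; have := @incC j k; rewrite !inE ?iB ?jB ?kB ij jk ik /=;
lia.
Qed.

(** A stable initial segment would send its elements of [B] to elements of [Q] inside it, so the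
    height there would not be positive. *)
Lemma path_irreducible : irreducible pi.
Proof.
apply/negP => /reducibleP[k [k0 kn stab]].
have [_ pos _ _] := pBQ.
have := pos k; rewrite k0 kn => /(_ isT); rewrite ltnNge => /negP; apply.
rewrite /below -[leqLHS](card_imset _ (@perm_inj _ pi)).
apply/subset_leq_card/subsetP => _ /imsetP[x + ->]; rewrite !inE => /andP[xB xk].
by rewrite mem_pi xB stab.
Qed.

(* The rank of its cycle: the j-th cycle is made of the j-th up step, the
   level steps between it and the next up step, and the j-th down step. *)
Definition cycle_rank x :=
  if x \in B then below (~: Q) x.+1 else below (~: B) x.+1.

Lemma cycle_rank_perm x : cycle_rank (pi x) = cycle_rank x.
Proof.
have [_ pos eqc lev] := pBQ; rewrite /cycle_rank.
have [xB|xB] := boolP (x \in B); last first.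
  (* A down step is mapped to the up step of the same rank. *)
  by rewrite CQ_B ?mem_pi // !belowS !inE mem_pi xB pi_C.
have x_lt : x < pi x by move: (xB); rewrite -{1}path_exc inE.
have qy := pi_B xB; have yQ : pi x \in Q by rewrite mem_pi.
have bx := belowS B x; rewrite xB in bx.
have yn := ltnW (ltn_ord (pi x)).
have split k : below (B :&: Q) k + below (~: Q) k = below B k.
  rewrite (below_split B Q); congr (_ + below _ _); apply/setP => z.
  by rewrite !inE andb_idr // => /CQ_B.
(* A level step strictly between [x] and [pi x] would have height at least 2. *)
have noN : below (B :&: Q) (pi x) = below (B :&: Q) x.+1.
  apply/eqP; rewrite eqn_leq (leq_below _ x_lt) andbT leqNgt; apply/negP => /ltn_below_ex[z].
  rewrite inE => /andP[zB zQ] /andP[xz zy].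
  have := lev z zB zQ; have := leq_below B xz; have := ltn_below zQ zy; lia.
have [yB|yB] := boolP (pi x \in B).
  rewrite (belowS _ (pi x)) inE yQ add0n.
  have := lev _ yB yQ; have := split (pi x); have := split x.+1; lia.
rewrite belowS inE yB; have := split (pi x); have := split x.+1.
have := belowC B yn; have := belowC Q yn; lia.
Qed.

Lemma cycle_rank_porbit x y : y \in porbit pi x -> cycle_rank y = cycle_rank x.
Proof.
by case/porbitP => i ->; rewrite permX; elim: i => //= i IH; rewrite cycle_rank_perm.
Qed.

(** A cycle maximum is not an excedance, so it lies outside [B]; [cycle_rank] is injective there, so
    a cycle has just one such element. *)
Lemma path_cycle_max x : cycle_max pi x = (x \notin B).
Proof.
have maxC y : cycle_max pi y -> y \notin B.
  move=> /forall_inP mx; rewrite -path_exc inE -leqNgt; apply: mx.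
  by rewrite mem_porbit1.
apply/idP/idP => [|xB]; first exact: maxC.
have [m mm] := cycle_max_exists pi x; rewrite mem_orbit_porbit => /cycle_rank_porbit.
have mB := maxC _ mm; rewrite /cycle_rank (negPf xB) (negPf mB) !belowS !inE xB mB !add1n.
by move=> [] /below_inj -> //; rewrite inE.
Qed.

Lemma path_theta_avoids : avoids p321 (theta pi).
Proof.
rewrite avoids321_theta; apply/pairwise_theta_wordP; split=> [m mm|m m' mm mm' lt].
  apply/pairwise_orbitP => i j + jo.
  (* Within a cycle every entry after the first is an excedance, so the entries climb. *)
  elim: j jo => // j IH jo; rewrite ltnS leq_eqVlt => /orP[/eqP<-|ij].
    apply/implyP; rewrite path_cycle_max negbK => iB; apply/implyP => _ /=.
    by move: iB; rewrite -{1}path_exc inE.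
  have /implyP := IH (ltnW jo) ij; move=> IH'; apply/implyP => ni; apply/implyP => _.
  have nj : ~~ cycle_max pi (iter j pi m).
    by apply: cycle_max_iter => //; rewrite (ltnW jo) andbT; lia.
  have /implyP/(_ nj) lt := IH' ni; apply: ltn_trans lt _ => /=.
  by move: nj; rewrite path_cycle_max negbK -{1}path_exc inE.
apply/allrelP => x y; rewrite !mem_orbit_porbit => /cycle_rank_porbit cx /cycle_rank_porbit cy.
apply/implyP; rewrite path_cycle_max negbK => xB.
apply/implyP; rewrite path_cycle_max negbK => yB.
move: mm mm' cx cy; rewrite !path_cycle_max => mB m'B.
rewrite /cycle_rank xB yB (negPf mB) (negPf m'B) => cx cy.
(* The rank is strictly increasing outside [B] and weakly increasing on [B], so the cycle with the
   larger maximum has the larger entries in [B]. *)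
have := belowS (~: B) m'; rewrite inE m'B => e1.
rewrite ltnNge; apply/negP => yx.
have := leq_below (~: Q) (yx : y.+1 <= x.+1); have := leq_below (~: B) lt; lia.
Qed.

End Backward.

Lemma path_pair_fair B Q : 1 < n -> path_pair B Q ->
  exists pi, [/\ fair pi, exc pi = B & pi @: exc pi = Q].
Proof.
move=> n1 pBQ; have [_ _ eqc _] := pBQ.
have [pi [piB iB iC]] := incr_perm_exists eqc.
exists pi; have e := path_exc n1 pBQ piB iB iC; split; rewrite ?e //; apply/and3P; split.
- exact: (path_irreducible pBQ piB).
- exact: path_avoids iC.
- exact: (path_theta_avoids n1 pBQ piB).
Qed.

End Correspondence.

(** * Counting the paths *)

(* Steps are pairs of booleans: (true, false) is up, (false, true) is down and
   (true, true) is level, matching [path_word] below. *)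
Notation step := (bool * bool)%type.

(* The paths from height h that first reach height 0 at their end, and whose
   level steps are at height 1. *)
Fixpoint first_passage (h : nat) (w : seq step) : bool :=
  match h, w with
  | 0, [::] => true
  | h'.+1, (true, false) :: w' => first_passage h'.+2 w'
  | h'.+1, (false, true) :: w' => first_passage h' w'
  | h'.+1, (true, true) :: w' => (h' == 0) && first_passage 1 w'
  | _, _ => false
  end.

Lemma first_passage_cons h a b w :
  first_passage h.+1 ((a, b) :: w) =
  [&& a || b, a && b ==> (h == 0) & first_passage (h.+1 + a - b) w].
Proof.
case: a; case: b => //=; rewrite ?addn1 ?addn0 ?subn0 ?subn1 //=.
by case: eqP => // ->.
Qed.

(** The recursion is put in terms of prefix counts, the form taken by [path_pair]. *)
Lemma first_passageP h w :
  first_passage h w <->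
  [/\ all (fun a => a.1 || a.2) w,
      forall k, k < size w -> count snd (take k w) < h + count fst (take k w),
      h + count fst w = count snd w &
      forall k, k < size w -> nth (false, false) w k = (true, true) ->
        h + count fst (take k w) = (count snd (take k w)).+1].
Proof.
elim: w h => [|[a b] w IH] h.
  by case: h => [|h] /=; split=> // -[]; rewrite ?addn0.
case: h => [|h]; first by split=> //= -[_ /(_ 0) /= /(_ isT)].
rewrite first_passage_cons; split.
  case/and3P=> ab lev /IH[al pos tot lv]; split; rewrite /= ?ab //.
  - by case=> [|k] //= /pos; lia.
  - by move: tot; lia.
  - case=> [|k] /=; last by move=> kw e; have := lv k kw e; lia.
    by move=> _ [ea eb]; move: lev; rewrite ea eb /= => /eqP->.
case=> /= /andP[ab al] pos tot lv; apply/and3P; split=> //.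
  apply/implyP => /andP[ea eb]; have := lv 0 isT; rewrite /= ea eb => /(_ erefl); lia.
apply/IH; split=> //.
- by move=> k kw; have := pos k.+1 kw; rewrite /=; lia.
- by move: tot; lia.
- by move=> k kw e; have := lv k.+1 kw e; rewrite /=; lia.
Qed.

Fixpoint paths (m h : nat) : seq (seq step) :=
  match m, h with
  | 0, 0 => [:: [::]]
  | m'.+1, h'.+1 =>
      [seq (true, false) :: w | w <- paths m' h'.+2] ++
      [seq (false, true) :: w | w <- paths m' h'] ++
      (if h' == 0 then [seq (true, true) :: w | w <- paths m' 1] else [::])
  | _, _ => [::]
  end.

Lemma mem_map_cons (T : eqType) (a b : T) (w : seq T) s :
  (a :: w \in [seq b :: v | v <- s]) = (a == b) && (w \in s).
Proof.
apply/mapP/andP => [[v vs [-> ->]]|[/eqP-> ws]]; first by rewrite eqxx.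
by exists w.
Qed.

Lemma mem_paths m h w : (w \in paths m h) = (size w == m) && first_passage h w.
Proof.
elim: m h w => [|m IH] [|h] w; try by case: w => [|[[] []] w] //=; rewrite ?andbF ?inE.
rewrite /= !mem_cat; case: w => [|[a b] w].
  by apply/negbTE; rewrite !negb_or; apply/and3P; split; [| |case: ifP => // _];
     apply/mapP => -[].
have -> : (((a, b) :: w \in if h == 0 then [seq (true, true) :: w | w <- paths m 1] else [::])
  = (h == 0) && (((a, b) == (true, true)) && (w \in paths m 1))).
  by case: ifP => _; rewrite ?mem_map_cons.
rewrite !mem_map_cons !IH -[size (_ :: w)]/(size w).+1 eqSS.
by case: a; case: b; rewrite /= ?andbF ?orbF //; exact: andbCA.
Qed.

Lemma uniq_paths m h : uniq (paths m h).
Proof.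
elim: m h => [|m IH] [|h] //=.
have consI a : injective (cons a : seq step -> seq step) by move=> u v [].
rewrite !cat_uniq !map_inj_uniq ?IH //=; apply/and3P; split.
- apply/hasPn => w; rewrite mem_cat; case: w => [|[a b] w].
    by move=> _; apply/mapP => -[].
  rewrite !mem_map_cons; case: ifP => _; rewrite ?mem_map_cons;
  by case: a; case: b; rewrite /= ?orbF.
- case: ifP => _ //; apply/hasPn => w /mapP[v _ ->]; by rewrite mem_map_cons.
- by case: ifP => // _; rewrite map_inj_uniq.
Qed.

(** For [h <= m] this is also the number of unrestricted walks with [m] steps +1 or -1 from height
    [h] to 0 or -1, according to the parity of [m - h]. *)
Definition npaths h m := if h <= m then 'C(m, (m - h)./2) else 0.

Lemma npaths0 m : npaths 0 m.+1 = npaths 0 m + npaths 1 m.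
Proof.
rewrite /npaths /= !subn0; case: m => [|m] //=; rewrite subn1 /=.
have [e|e] := boolP (odd m).
  by rewrite uphalf_half e add1n binS.
(* Pascal's rule yields the two middle coefficients of an odd row, which are equal. *)
rewrite uphalf_half (negPf e) add0n binS addnC; congr (_ + _).
rewrite -bin_sub; last by lia.
by congr binomial; lia.
Qed.

Lemma npathsS h m : npaths h.+1 m.+1 = npaths h.+2 m + npaths h m.
Proof.
rewrite /npaths ltnS subSS; case: (leqP h.+2 m) => [lt|].
  have -> : h <= m by lia.
  have -> : (m - h)./2 = (m - h.+2)./2.+1 by lia.
  by rewrite binS addnC.
rewrite ltnS add0n => le; case: leqP => // le'.
have -> : (m - h)./2 = 0 by lia.
by rewrite !bin0.
Qed.

(** Both sides obey the recursion on the first step. The right side lowers heights by one and omits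
    the last step, which is always down. *)
Lemma size_paths m h : size (paths m.+1 h.+1) = npaths h m.
Proof.
elim: m h => [|m IH] h; first by case: h.
rewrite [paths _ _]/= -/(paths m.+1 _) !size_cat !size_map IH; case: h => [|h] /=.
  by rewrite size_map IH npaths0 add0n addnC.
by rewrite IH addn0 npathsS.
Qed.

(** * Words of steps and pairs of sets *)

Section Words.
Variable n : nat.
Implicit Types (A B Q : {set 'I_n}) (pi : 'S_n).

Definition path_word B Q : seq step := [seq (x \in B, x \in Q) | x <- enum 'I_n].

Lemma size_path_word B Q : size (path_word B Q) = n.
Proof. by rewrite size_map size_enum_ord. Qed.

Lemma nth_path_word B Q (x : 'I_n) a : nth a (path_word B Q) x = (x \in B, x \in Q).
Proof. by rewrite (nth_map x) ?size_enum_ord // nth_ord_enum. Qed.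

Lemma path_word_inj B Q B' Q' : path_word B Q = path_word B' Q' -> B = B' /\ Q = Q'.
Proof.
move=> e; split; apply/setP => x;
have := nth_path_word B Q x (false, false); rewrite e nth_path_word; by case.
Qed.

Lemma count_take_enum A k : k <= n -> count (mem A) (take k (enum 'I_n)) = below A k.
Proof.
elim: k => [|k IH] kn; first by rewrite take0 below0.
pose x := Ordinal kn; rewrite (take_nth x) ?size_enum_ord // -cats1 count_cat IH ?(ltnW kn) //.
by rewrite -[k]/(val x) nth_ord_enum belowS /= addn0 addnC.
Qed.

Lemma count_fst_path_word B Q k : k <= n ->
  count fst (take k (path_word B Q)) = below B k.
Proof. by move=> kn; rewrite -map_take count_map -count_take_enum. Qed.

Lemma count_snd_path_word B Q k : k <= n ->
  count snd (take k (path_word B Q)) = below Q k.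
Proof. by move=> kn; rewrite -map_take count_map -count_take_enum. Qed.

Lemma path_word_surj w : size w = n -> exists B Q, path_word B Q = w.
Proof.
move=> sw; exists [set x : 'I_n | (nth (false, false) w x).1].
exists [set x : 'I_n | (nth (false, false) w x).2].
apply: (@eq_from_nth _ (false, false)); rewrite size_path_word // => i lt.
by rewrite (nth_path_word _ _ (Ordinal lt)) !inE /=; case: nth.
Qed.

(** Positive height after one step forces an up step first; the rest starts at height 1, whence the
    shift by one in prefix lengths. *)
Lemma path_pairP B Q : 1 < n ->
  path_pair B Q <->
  exists2 w, path_word B Q = (true, false) :: w & first_passage 1 w.
Proof.
move=> n1; have n0 := ltnW n1.
have cB := count_fst_path_word B Q; have cQ := count_snd_path_word B Q.
have nt := nth_path_word B Q; have sz := size_path_word B Q.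
have al : all (fun a => a.1 || a.2) (path_word B Q) = (~: B \subset Q).
  rewrite all_map; apply/allP/subsetP => H x; have := H x; rewrite ?mem_enum !inE /=.
    by move/(_ isT)/orP => [->|].
  by case: (x \in B) => //= /(_ isT).
have := cB n (leqnn n); have := cQ n (leqnn n).
rewrite !take_oversize ?sz // !below_full => tQ tB.
split.
  case=> sub pos eqc lev.
  have := pos 1; rewrite n1 => /(_ isT); rewrite -cB // -cQ //.
  case: (path_word B Q) cB cQ nt sz al tB tQ => [|[a b] w] cB cQ nt sz al tB tQ //.
  rewrite /= take0 /= !addn0 => ab.
  have [ea eb] : a = true /\ b = false by case: (a) (b) ab => -[].
  exists w; first by rewrite ea eb.
  apply/first_passageP; split.
  - by move: al; rewrite sub /= => /andP[].
  - move=> k kw; have kn : k.+1 < n by rewrite -sz.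
    by have := pos k.+1 kn; rewrite -cB ?(ltnW kn) // -cQ ?(ltnW kn) //= ea eb; lia.
  - by move: tB tQ; rewrite /= ea eb => tB tQ; rewrite -[LHS]/(true + count fst w) tB eqc -tQ.
  move=> k kw e; have kn : k.+1 < n by rewrite -sz.
  have := nt (Ordinal kn) (false, false); rewrite /= e => -[/esym xB /esym xQ].
  by have := lev _ xB xQ; rewrite -cB ?(ltnW kn) // -cQ ?(ltnW kn) //= ea eb; lia.
case=> w ew /first_passageP[all_w pos tot lev].
rewrite ew in cB cQ nt sz al tB tQ; split.
- by rewrite -al /= all_w.
- case=> // k kn; rewrite -cB ?(ltnW kn) // -cQ ?(ltnW kn) //=.
  have kw : k.+1 < size ((true, false) :: w) by rewrite sz.
  by have := pos k kw; lia.
- by rewrite -tB -tQ /=; lia.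
move=> x xB xQ; have := nt x (false, false); rewrite xB xQ.
rewrite -cB ?(ltnW (ltn_ord x)) // -cQ ?(ltnW (ltn_ord x)) //.
have : x < size ((true, false) :: w) by rewrite sz ltn_ord.
case: (val x) => [|k] //= kw e.
by have := lev k kw e; lia.
Qed.

End Words.

(** [W] is injective by [fair_inj], has its values among the paths by [fair_path_pair], and reaches
    all of them by [path_pair_fair]. *)
Lemma a_num_paths n : 1 < n -> a_num p321 n = size (paths n.-1 1).
Proof.
move=> n1; pose F := [set pi : 'S_n | fair pi].
pose W (pi : 'S_n) := path_word (exc pi) (pi @: exc pi).
transitivity (size [seq W pi | pi <- enum F]); first by rewrite size_map -cardE.
transitivity (size [seq (true, false) :: w | w <- paths n.-1 1]); last by rewrite size_map.
apply/perm_size/uniq_perm.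
- rewrite map_inj_in_uniq ?enum_uniq // => pi pi'; rewrite !mem_enum !inE => f f'.
  by case/path_word_inj; apply: fair_inj.
- by rewrite map_inj_uniq ?uniq_paths // => u v [].
move=> w; apply/mapP/mapP => [[pi]|[v]].
  rewrite mem_enum inE => f ->; have := fair_path_pair n1 f.
  case/(path_pairP _ _ n1) => v e fp; exists v => //; rewrite mem_paths fp andbT.
  by have := size_path_word (exc pi) (pi @: exc pi); rewrite e /= => <-.
rewrite mem_paths => /andP[/eqP sv fp] ->.
have [|B [Q e]] := @path_word_surj n ((true, false) :: v); first by rewrite /= sv; lia.
have [|pi [f eB eQ]] := @path_pair_fair n B Q n1.
  by apply/path_pairP => //; exists v.
by exists pi; rewrite ?mem_enum ?inE // /W eQ eB.
Qed.

Lemma a_num_npaths n : a_num p321 n.+2 = npaths 0 n.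
Proof. by rewrite a_num_paths //= size_paths. Qed.

Lemma a_num1 : a_num p321 1 = 1.
Proof.
rewrite /a_num -[RHS](_ : #|[set: 'S_1]| = 1); last by rewrite cardsT card_Sn.
apply: eq_card => s; rewrite !inE; apply/and3P; split.
- by apply/negP => /reducibleP[k [k0 k1 _]]; lia.
- by apply/avoids321P => i j k; rewrite !ord1.
- by apply/avoids321P => i j k; rewrite !ord1.
Qed.

(** * Generating functions *)

Import GRing.Theory.
Local Open Scope ring_scope.

Section PowerSeries.
Variable F : fieldType.
Implicit Types (f g : fps F).

Lemma fcoefXM f n : (fpsX * f)`_[n] = if n is n'.+1 then f`_[n'] else 0.
Proof.
rewrite fcoefM; case: n => [|n]; first by rewrite big_ord1 mul0r.
rewrite 2!big_ord_recl /= mul0r add0r mul1r big1 ?addr0 ?subn1 // => i _.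
by rewrite mul0r.
Qed.

Lemma fcoefXnM k f n : (fpsX ^+ k * f)`_[n] = if (k <= n)%N then f`_[n - k] else 0.
Proof.
elim: k n => [|k IH] n; first by rewrite expr0 mul1r subn0.
by rewrite exprS -mulrA fcoefXM; case: n => [|n] //; rewrite IH ltnS subSS.
Qed.

Lemma fcoefXn k n : (fpsX ^+ k : fps F)`_[n] = (n == k)%:R.
Proof.
rewrite -[fpsX ^+ k]mulr1 fcoefXnM /= subn_eq0 eqn_leq andbC.
by case: (k <= n)%N.
Qed.

Lemma fcoef_compXX f n :
  (fps_comp f (fpsX ^+ 2))`_[n] = if odd n then 0 else f`_[n./2].
Proof.
rewrite /=; under eq_bigr do rewrite -exprM fcoefXn.
case: ifP => [on|en].
  by apply: big1 => k _; case: eqP => [e|_]; rewrite ?mulr0 //; rewrite e oddM in on.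
have lt : (n./2 < n.+1)%N by lia.
rewrite (bigD1 (Ordinal lt)) //= big1 ?addr0 => [|k nk].
  by rewrite [(2 * _)%N](_ : _ = n) ?eqxx ?mulr1 //; lia.
case: eqP => [e|]; rewrite ?mulr0 //; case/eqP: nk; apply/val_inj => /=.
lia.
Qed.

Lemma sum_even_terms k (a : nat -> F) : (forall i, odd i -> a i = 0) ->
  \sum_(i < k.*2.+1) a i = \sum_(j < k.+1) a j.*2.
Proof.
move=> a0; elim: k => [|k IH]; first by rewrite !big_ord1.
rewrite doubleS big_ord_recr big_ord_recr /= IH [in RHS]big_ord_recr /=.
by rewrite a0 ?addr0 ?doubleS //= odd_double.
Qed.

(** This is c(x^2), not the square of c. *)
Definition catalan_sqr : fps F := fps_comp catalan_gf (fpsX ^+ 2).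

(** This is c = 1 + x c^2 at x^2, read on coefficients: the odd ones vanish and the even ones
    satisfy the Catalan convolution. *)
Lemma catalan_sqr_eq : (2 : F) != 0 ->
  catalan_sqr = 1 + fpsX ^+ 2 * catalan_sqr ^+ 2.
Proof.
move=> nz2; have ce := catalan_gf_eq nz2; apply/fpsP => n.
have cS k : (@catalan_gf F)`_[k.+1] = \sum_(i < k.+1) catalan_gf`_[i] * catalan_gf`_[k - i].
  by rewrite {1}ce -[LHS]/(0 + (fpsX * catalan_gf ^+ 2)`_[k.+1]) add0r fcoefXM expr2 fcoefM.
have c0 : (@catalan_gf F)`_[0] = 1 by rewrite ce /= big_ord1 mul0r addr0.
rewrite -[RHS]/((1 : fps F)`_[n] + (fpsX ^+ 2 * catalan_sqr ^+ 2)`_[n]) fcoefXnM fcoef_compXX.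
case: n => [|[|n]]; rewrite ?addr0 //.
rewrite -[RHS]/(0 + (catalan_sqr ^+ 2)`_[n.+2 - 2]) add0r subn2 expr2 fcoefM.
rewrite -[odd _]/(~~ ~~ odd n) negbK -[n.+2./2]/(n./2).+1.
case: ifP => on.
  rewrite big1 // => i _; rewrite !fcoef_compXX.
  case: ifP => oi; rewrite ?mul0r // ifT ?mulr0 // oddB ?on ?oi //.
  by rewrite -ltnS.
rewrite -[in RHS](odd_double_half n) on add0n.
pose a i := catalan_sqr`_[i] * catalan_sqr`_[n./2.*2 - i].
rewrite (sum_even_terms _ (a := a)); last first.
  by move=> i oi; rewrite /a fcoef_compXX oi mul0r.
rewrite cS; apply: eq_bigr => i _.
by rewrite /a -doubleB !fcoef_compXX !odd_double !doubleK.
Qed.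

End PowerSeries.

(** * Generating functions of the path numbers *)

Definition npaths_gf h : fps rat := Fps (fun m => (npaths h m)%:R).

Lemma npaths_gf0 : npaths_gf 0 = 1 + fpsX * (npaths_gf 0 + npaths_gf 1).
Proof.
apply/fpsP => n.
rewrite -[RHS]/((1 : fps rat)`_[n] + (fpsX * (npaths_gf 0 + npaths_gf 1))`_[n]) fcoefXM.
by case: n => [|n] /=; rewrite ?addr0 // add0r npaths0 natrD.
Qed.

Lemma npaths_gfS h : npaths_gf h.+1 = fpsX * (npaths_gf h.+2 + npaths_gf h).
Proof.
by apply/fpsP => n; rewrite fcoefXM; case: n => [|n] //=; rewrite npathsS natrD.
Qed.

(* The differences G h = H (h+1) - x C H h satisfy G h = x C G (h+1), so they
   are divisible by every power of x. *)
Lemma npaths_gf1 : npaths_gf 1 = fpsX * catalan_sqr rat * npaths_gf 0.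
Proof.
set C := catalan_sqr rat; have Ce : C = 1 + fpsX ^+ 2 * C ^+ 2 by apply: catalan_sqr_eq.
pose G h := npaths_gf h.+1 - fpsX * C * npaths_gf h.
have GS h : G h = fpsX * C * G h.+1.
  rewrite /G; have := npaths_gfS h.
  move: (npaths_gf h) (npaths_gf h.+1) (npaths_gf h.+2) => H0 H1 H2 e.
  have e2 : fpsX * H2 = H1 - fpsX * H0 by rewrite e; ring.
  transitivity (C * (fpsX * H2) - fpsX ^+ 2 * C ^+ 2 * H1); last by ring.
  (* The equation for [C] is used as 1 = C - x^2 C^2, multiplied by [H1]. *)
  rewrite e2 {1}[H1](_ : _ = (C - fpsX ^+ 2 * C ^+ 2) * H1); first by ring.
  by rewrite [X in X - _]Ce addrK mul1r.
have Gk k : G 0%N = fpsX ^+ k * (C ^+ k * G k).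
  by elim: k => [|k ->]; rewrite ?expr0 ?mul1r // GS !exprS; ring.
suff /eqP : G 0%N = 0 by rewrite subr_eq0 => /eqP.
by apply/fpsP => n; rewrite (Gk n.+1) fcoefXnM ltnn.
Qed.

Lemma npaths_gf0_catalan :
  npaths_gf 0 * (1 - fpsX - fpsX ^+ 2 * catalan_sqr rat) = 1.
Proof.
have := npaths_gf0; rewrite npaths_gf1; move: (npaths_gf 0) (catalan_sqr rat) => A C e.
have -> : A * (1 - fpsX - fpsX ^+ 2 * C) = A - fpsX * (A + fpsX * C * A) by ring.
by rewrite {1}e addrK.
Qed.

(** The term x is the permutation of size 1, and x^2 accounts for the removed first and last
    steps. *)
Lemma a321_gfE : a321_gf = fpsX + fpsX ^+ 2 * npaths_gf 0.
Proof.
apply/fpsP => n.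
rewrite -[RHS]/((fpsX : fps rat)`_[n] + (fpsX ^+ 2 * npaths_gf 0)`_[n]) fcoefXnM /=.
case: n => [|[|n]] /=; rewrite ?addr0 ?a_num1 //.
by rewrite add0r a_num_npaths subn2.
Qed.

Theorem theorem3p15 :
  (forall n : nat, (2 <= n)%N -> a_num p321 n = 'C(n - 2, (n - 2) %/ 2)) /\
  a321_gf =
    (fpsX - fpsX ^+ 3 * fps_comp catalan_gf (fpsX ^+ 2)) /
    (1 - fpsX - fpsX ^+ 2 * fps_comp catalan_gf (fpsX ^+ 2)).
Proof.
split=> [[|[|n]] // _|]; first by rewrite a_num_npaths /npaths subn0 subn2 divn2.
rewrite -/(catalan_sqr rat) a321_gfE; have := npaths_gf0_catalan.
move: (npaths_gf 0) (catalan_sqr rat) => A C e.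
have u : 1 - fpsX - fpsX ^+ 2 * C \is a GRing.unit by apply/unitrPr; exists A; rewrite mulrC.
apply: (mulIr u); rewrite divrK //.
(* As [A] is inverse to the denominator, this equals x (1 - x - x^2 C) + x^2, the required
   numerator. *)
transitivity (fpsX * (1 - fpsX - fpsX ^+ 2 * C) +
              fpsX ^+ 2 * (A * (1 - fpsX - fpsX ^+ 2 * C))); first by ring.
by rewrite e; ring.
Qed.
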